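(* Let $b\ge2$ and $\mathcal Y=\{0,\dots,b-1\}^k$, and let $\mathcal P$ be a class of full-support product distributions over $\mathcal Y$ (distributions whose $k$ coordinates are mutually independent) such that for some $M\le\mathrm{poly}(k,b)$, every $P=P_1\times\cdots\times P_k\in\mathcal P$, every coordinate $j$ and every $y_j\in\{0,\dots,b-1\}$ satisfy $\log(1/P_j(y_j))\le M$. Then there exists a parametric class of events $\mathcal E(\cdot)$ such that for any $\gamma>0$ and any $P,Q\in\mathcal P$ with $\mathrm{KL}(P\|Q)\ge\gamma$, the class $\mathcal E(\gamma)$ contains an event $E$ that is $\xi$-distinguishing for $P$ and $Q$, where $\max\{1/\xi,|\mathcal E(\gamma)|\}\le\mathrm{poly}(k,b,1/\gamma)$.
   Context: An event $E\subseteq\mathcal Y$ is $\xi$-distinguishing for distributions $P,Q$ if $|P(E)-Q(E)|\ge\xi$, where $P(E)=\Pr_{y\sim P}[y\in E]$. A parametric class of events is a map assigning to each $\gamma>0$ a set $\mathcal E(\gamma)$ of events. Logarithms are base 2. *)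

(* Defs.v *)
From mathcomp Require Export all_boot all_order all_algebra.
From mathcomp Require Export classical_sets reals interval_inference exp.
(* Loaded without Import: the notations of mpoly clash with those loaded above. *)
From mathcomp Require mpoly.

Set Implicit Arguments.
Unset Strict Implicit.
Unset Printing Implicit Defensive.
Import Order.TTheory GRing.Theory Num.Theory.
Local Open Scope ring_scope.

Record fdist (R : realType) (T : finType) := FDist {
  pmf :> {ffun T -> R};
  pmf_ge0 : forall x, 0 <= pmf x;
  pmf_sum1 : \sum_x pmf x = 1
}.

Definition Pr (R : realType) (T : finType) (P : fdist R T) (E : {set T}) : R :=
  \sum_(y in E) P y.

Definition full_support (R : realType) (T : finType) (P : fdist R T) : Prop :=
  forall y, 0 < P y.

Definition log2 (R : realType) (x : R) : R := ln x / ln 2.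

(* Real-valued, hence the usual divergence only when Q y = 0 implies P y = 0;
   it is only meant for Q of full support. *)
Definition KL (R : realType) (T : finType) (P Q : fdist R T) : R :=
  \sum_y P y * log2 (P y / Q y).

Definition distinguishing (R : realType) (T : finType) (xi : R)
    (P Q : fdist R T) (E : {set T}) : Prop :=
  xi <= `|Pr P E - Pr Q E|.

Definition parametric_class (R : realType) (T : finType) :=
  {posnum R} -> {set {set T}}.

Definition strings (k b : nat) : finType := {ffun 'I_k -> 'I_b}.

Section Marginal.
Variables (R : realType) (k b : nat) (P : fdist R (strings k b)) (j : 'I_k).

Definition marginal_pmf : {ffun 'I_b -> R} :=
  [ffun v => Pr P [set y : strings k b | y j == v]].

Lemma marginal_ge0 v : 0 <= marginal_pmf v.
Proof. by rewrite ffunE; apply: sumr_ge0 => y _; apply: pmf_ge0. Qed.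

Lemma marginal_sum1 : \sum_v marginal_pmf v = 1.
Proof.
rewrite -(pmf_sum1 P) (partition_big (fun y : strings k b => y j) predT) //=.
by apply: eq_bigr => v _; rewrite ffunE; apply: eq_bigl => y; rewrite inE.
Qed.

Definition marginal : fdist R 'I_b := FDist marginal_ge0 marginal_sum1.

End Marginal.

Definition independent_coordinates (R : realType) (k b : nat)
    (P : fdist R (strings k b)) : Prop :=
  forall (J : {set 'I_k}) (A : 'I_k -> {set 'I_b}),
    Pr P [set y : strings k b | [forall j in J, y j \in A j]] =
    \prod_(j in J) Pr P [set y : strings k b | y j \in A j].

(* A bound poly(x_1, ..., x_n) is a real polynomial in n variables, evaluated at
   the parameters and fixed before them. *)
Definition rpoly (R : realType) (n : nat) := mpoly.mpoly n R.

Definition peval (R : realType) (n : nat) (p : rpoly R n) (x : n.-tuple R) : R :=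
  mpoly.meval (tnth x) p.

(* Main.v *)
(** An independent family satisfies KL(P || Q) = \sum_j KL(P_j || Q_j), so a large
    divergence shows up in one coordinate.  There, since x log (x / y) is at most
    (x - y) log (1 / y) + O(x - y) when x > y and nonpositive otherwise, the bound
    log (1 / Q_j v) <= M makes KL(P_j || Q_j) at most (M + 2) times the l1-distance
    between P_j and Q_j.  Hence some of the k * b events [y_j = v] separates P from Q
    with an inverse polynomial gap. *)
Require Import Defs.
From mathcomp Require Import ring lra.
From mathcomp Require Import(canonicals) mpoly.
Set Implicit Arguments.
Unset Strict Implicit.
Unset Printing Implicit Defensive.
Import Order.TTheory GRing.Theory Num.Theory.
Local Open Scope ring_scope.

Lemma ln_le_subr1 (R : realType) (x : R) : 0 < x -> ln x <= x - 1.
Proof.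
move=> x_gt0; rewrite -[X in ln X](addrNK 1) [X in ln X]addrC.
by apply: le_ln1Dx; lra.
Qed.

(** Apply [ln x <= x - 1] at [x = 1/2]. The resulting [1 / ln 2 <= 2] is the source of the [2] in
    the factor [M + 2] below. *)
Lemma ln2_ge_half (R : realType) : 2^-1 <= ln (2 : R).
Proof.
have := @ln_le_subr1 R 2^-1 ltac:(by lra).
by rewrite lnV ?posrE //; lra.
Qed.

Lemma log2_prod (R : realType) (I : finType) (F : I -> R) :
  (forall i, 0 < F i) -> log2 (\prod_i F i) = \sum_i log2 (F i).
Proof.
move=> F_gt0.
suff [] : 0 < \prod_i F i /\ log2 (\prod_i F i) = \sum_i log2 (F i) by [].
apply: (big_rec2 (fun x y => 0 < x /\ log2 x = y)).
  by rewrite /log2 ln1 mul0r.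
move=> i x y _ [x_gt0 <-]; split; first exact: mulr_gt0.
by rewrite /log2 lnM ?posrE // mulrDl.
Qed.

Lemma mul_log2_div_le (R : realType) (M x y : R) :
  0 < x <= 1 -> 0 < y -> 0 <= M -> log2 (1 / y) <= M ->
  x * log2 (x / y) <= `|x - y| * (M + 2).
Proof.
move=> /andP[x_gt0 x_le1] y_gt0 M_ge0 yM.
have ln2_gt0 : 0 < ln (2 : R) by have := ln2_ge_half R; lra.
case: (leP x y) => [le_xy|lt_yx].
  apply: (@le_trans _ _ 0); last by rewrite mulr_ge0 ?addr_ge0.
  rewrite pmulr_rle0 // /log2 pmulr_lle0 ?invr_gt0 // ln_le0 //.
  by rewrite ler_pdivrMr // mul1r.
have -> : `|x - y| = x - y by rewrite gtr0_norm ?subr_gt0.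
(* Split the leading factor as [x = (x - y) + y]. The first term is controlled by [x / y <= 1 / y],
   the second by [y * ln (x / y) <= x - y]. *)
rewrite -{1}(subrK y x) mulrDl mulrDr lerD //.
  apply: ler_wpM2l; first lra.
  apply: le_trans yM; rewrite /log2 ler_wpM2r ?invr_ge0 ?(ltW ln2_gt0) //.
  by rewrite ler_ln ?posrE ?divr_gt0 // ler_wpM2r ?invr_ge0 // ltW.
rewrite /log2 mulrA ler_pdivrMr //.
have le1 : y * ln (x / y) <= x - y.
  apply: (@le_trans _ _ (y * (x / y - 1))).
    by rewrite ler_wpM2l ?(ltW y_gt0) // ln_le_subr1 // divr_gt0.
  by rewrite mulrBr mulr1 mulrCA divff ?lt0r_neq0 // mulr1.
have := ln2_ge_half R; nra.
Qed.

Section Product.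
Variables (R : realType) (k b : nat).
Implicit Types P Q : fdist R (strings k b).

Lemma sum_marginal P (j : 'I_k) (f : 'I_b -> R) :
  \sum_y P y * f (y j) = \sum_v marginal P j v * f v.
Proof.
rewrite (partition_big (fun y : strings k b => y j) predT) //=.
apply: eq_bigr => v _; rewrite ffunE /Pr big_distrl /=.
by apply: eq_big => y; rewrite ?inE // => /eqP ->.
Qed.

Lemma marginal_le1 P j v : marginal P j v <= 1.
Proof.
rewrite -(pmf_sum1 (marginal P j)) (bigD1 v) //= lerDl.
by apply: sumr_ge0 => u _; apply: marginal_ge0.
Qed.

Lemma marginal_gt0 P j v : full_support P -> 0 < marginal P j v.
Proof.
move=> Pfull; rewrite ffunE /Pr (bigD1 [ffun=> v]) ?inE ?ffunE //=.
by rewrite ltr_pwDl // sumr_ge0 // => y _; apply: pmf_ge0.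
Qed.

Lemma independent_pmf P y :
  independent_coordinates P -> P y = \prod_j marginal P j (y j).
Proof.
move=> /(_ [set: 'I_k]%SET (fun j => [set y j])).
have -> : [set x : strings k b | [forall j in [set: 'I_k]%SET, x j \in [set y j]]]
    = [set y].
  apply/setP=> x; rewrite !inE; apply/forallP/eqP => [xy|-> j].
    by apply/ffunP=> j; have := xy j; rewrite !inE => /eqP.
  by rewrite !inE eqxx.
rewrite {1}/Pr big_set1 => ->; apply: eq_big => j; first by rewrite inE.
by move=> _; rewrite ffunE; congr Pr; apply/setP=> x; rewrite !inE.
Qed.

(** The logarithm turns the product of marginal ratios into a sum over coordinates. Its [j]-th term
    depends on [y] only through [y j], so averaging it over [P] is averaging over the marginal. *)
Lemma KL_independent P Q :
  full_support P -> full_support Q ->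
  independent_coordinates P -> independent_coordinates Q ->
  KL P Q = \sum_j KL (marginal P j) (marginal Q j).
Proof.
move=> Pfull Qfull Pind Qind.
under [RHS]eq_bigr => j _ do
  rewrite /KL -(sum_marginal P j
    (fun v => log2 (marginal P j v / marginal Q j v))).
rewrite exchange_big; apply: eq_bigr => y _ /=.
rewrite -mulr_sumr (independent_pmf y Pind) (independent_pmf y Qind).
rewrite -prodf_div log2_prod // => j.
by rewrite divr_gt0 ?marginal_gt0.
Qed.

(** Contrapositive form of the main step: if no coordinate event has a gap above [xi], each of the
    [k * b] summands of the divergence is at most [xi * (M + 2)]. *)
Lemma KL_le_marginal_dist P Q (M xi : R) :
  full_support P -> full_support Q ->
  independent_coordinates P -> independent_coordinates Q ->
  0 <= M -> (forall j v, log2 (1 / marginal Q j v) <= M) ->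
  (forall j v, `|marginal P j v - marginal Q j v| <= xi) ->
  KL P Q <= k%:R * b%:R * (xi * (M + 2)).
Proof.
move=> Pfull Qfull Pind Qind M_ge0 QM PQ.
rewrite KL_independent // -natrM.
apply: (@le_trans _ _ (\sum_(j < k) \sum_(v < b) xi * (M + 2))); last first.
  by rewrite !sumr_const !card_ord -mulrnA mulnC mulr_natl.
apply: ler_sum => j _; apply: ler_sum => v _.
apply: (@le_trans _ _ (`|marginal P j v - marginal Q j v| * (M + 2))).
  by apply: mul_log2_div_le; rewrite ?marginal_gt0 ?marginal_le1.
by rewrite ler_wpM2r //; lra.
Qed.

Definition coordinate_events : {set {set strings k b}} :=
  [set [set y : strings k b | y jv.1 == jv.2] | jv : 'I_k * 'I_b].

Lemma card_coordinate_events : (#|coordinate_events| <= k * b)%N.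
Proof.
by apply: leq_trans (leq_imset_card _ _) _; rewrite card_prod !card_ord.
Qed.

End Product.

(* [p] is squared because it may be negative when the class is empty, and
   [k + 1] replaces [k] to allow [k = 0]. *)
Definition distinguishing_poly (R : realType) (p : rpoly R 2) : rpoly R 3 :=
  let X i : rpoly R 3 := mpoly.mpolyX R (mpoly.mnm1 i) in
  let k := X (inord 0) in let b := X (inord 1) in let g := X (inord 2) in
  (k + 1) * b * (mpoly.comp_mpoly [tuple k; b] p ^+ 2 + 3%:R) * g + k * b.

Lemma distinguishing_polyE (R : realType) (p : rpoly R 2) (k b g : R) :
  peval (distinguishing_poly p) [tuple k; b; g] =
  (k + 1) * b * (peval p [tuple k; b] ^+ 2 + 3) * g + k * b.
Proof.
rewrite /peval /distinguishing_poly expr2.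
rewrite !(mpoly.mevalD, mpoly.mevalM, mpoly.mevalXU, mpoly.meval1, mpoly.mevalMn).
rewrite mpoly.comp_mpoly_meval !(tnth_nth 0) !inordK //= expr2.
(* Both sides evaluate [p], at points that agree on each of the two indices. *)
set u := mpoly.meval _ p; set u' := mpoly.meval _ p.
suff -> : u = u' by [].
apply: mpoly.meval_eq => -[[|[|//]] ?];
  by rewrite !(tnth_nth 0) /= mpoly.mevalXU (tnth_nth 0) inordK.
Qed.

Theorem theorem8 (R : realType) (p : rpoly R 2) :
  exists q : rpoly R 3,
  forall (k b : nat) (hb : (2 <= b)%N)
    (Pcls : set (fdist R (strings k b)))
    (hfull : forall P, Pcls P -> full_support P)
    (hprod : forall P, Pcls P -> independent_coordinates P)
    (M : R) (hM : M <= peval p [tuple k%:R; b%:R])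
    (hlog : forall P, Pcls P -> forall (j : 'I_k) (v : 'I_b),
      log2 (1 / marginal P j v) <= M),
  exists E_ : parametric_class R (strings k b),
  forall gamma : {posnum R},
  exists2 xi : R, 0 < xi &
    Num.max (1 / xi) #|E_ gamma|%:R
      <= peval q [tuple k%:R; b%:R; 1 / gamma%:num] /\
    (forall P Q, Pcls P -> Pcls Q -> gamma%:num <= KL P Q ->
      exists2 E : {set strings k b}, E \in E_ gamma & distinguishing xi P Q E).
Proof.
exists (distinguishing_poly p) => k b hb Pcls hfull hprod M hM hlog.
(* The same events serve every [gamma]; only [xi] depends on it. *)
exists (fun=> coordinate_events k b) => gamma.
rewrite distinguishing_polyE.
move: (peval p _) hM => m hM; set g := gamma%:num.
have g_gt0 : 0 < g by rewrite /g.
have k_ge0 : 0 <= k%:R :> R by [].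
have b_gt0 : 0 < b%:R :> R by rewrite ltr0n (leq_trans _ hb).
have B_gt0 : 0 < m ^+ 2 + 3 by have := sqr_ge0 m; lra.
have den_gt0 : 0 < (k%:R + 1) * b%:R * (m ^+ 2 + 3).
  by rewrite !mulr_gt0 // ltr_wpDl.
exists (g / ((k%:R + 1) * b%:R * (m ^+ 2 + 3))); first exact: divr_gt0.
split.
  (* [1 / xi] is the first summand of the polynomial, and [k * b] bounds the number of events. *)
  rewrite ge_max; apply/andP; split.
    by rewrite div1r invf_div mul1r lerDl mulr_ge0 // ltW.
  apply: (@le_trans _ _ (k%:R * b%:R)).
    by rewrite -natrM ler_nat card_coordinate_events.
  by rewrite lerDr mulr_ge0 ?divr_ge0 ?ltW.
move=> P Q PP PQ; set xi := g / _ => gKL.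
have [/existsP[[j v] jv]|noE] := boolP
    [exists jv : 'I_k * 'I_b,
      xi <= `|marginal P jv.1 jv.2 - marginal Q jv.1 jv.2|].
  exists [set y : strings k b | y j == v]; first by apply/imsetP; exists (j, v).
  by move: jv; rewrite !ffunE.
have close j v : `|marginal P j v - marginal Q j v| <= xi.
  by rewrite leNgt; apply: contra noE => /ltW ?; apply/existsP; exists (j, v).
(* Unlike [m], the bound [m ^+ 2 + 1 >= m] is nonnegative whatever the sign of [m]. *)
have logQ j v : log2 (1 / marginal Q j v) <= m ^+ 2 + 1.
  by apply: le_trans (hlog _ PQ j v) (le_trans hM _); nra.
have mge : 0 <= m ^+ 2 + 1 by have := sqr_ge0 m; lra.
have := KL_le_marginal_dist (hfull _ PP) (hfull _ PQ) (hprod _ PP) (hprod _ PQ)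
  mge logQ close.
(* The factor [k / (k + 1) < 1] makes the bound strictly smaller than [g], contradicting [gKL]
   although [close] is not strict. *)
have -> : k%:R * b%:R * (xi * (m ^+ 2 + 1 + 2)) = g * (k%:R / (k%:R + 1)).
  by rewrite /xi; field; rewrite !lt0r_neq0 // ltr_wpDl.
move=> /(le_trans gKL); rewrite ler_pMr // ler_pdivlMr ?ltr_wpDl //; lra.
Qed.
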